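(* Let $e : X \to Y$ be a compactification of a completely regular space $X$ and $e^\flat : C(Y) \to B(X)$, $e^\flat(f)=f\circ e$, the corresponding basic extension. Let $s:X\to\beta X$ be the Stone–Čech compactification of $X$ and $s^\flat:C(\beta X)\to B(X)$, $s^\flat(f)=f\circ s$. (1) If $e^\flat$ satisfies the equivalent conditions (T), (BS), and (S), then $X$ is normal. (2) If $X$ is normal, then $s^\flat : C(\beta X) \to B(X)$ satisfies (T), (BS), and (S). (3) $X$ is normal iff $s^\flat$ satisfies (T), (BS), (S).
   Context: Completely regular spaces are Hausdorff. A compactification of a completely regular space $X$ is a topological embedding $e:X\to Y$ into a compact Hausdorff space $Y$ with $e[X]$ dense in $Y$. $C(Y)$ is the $\ell$-algebra (lattice-ordered $\mathbb R$-algebra) of continuous real-valued functions on $Y$, and $B(X)$ the $\ell$-algebra of all bounded real-valued functions on the set $X$, both with pointwise operations and order. For an injective unital $\ell$-algebra homomorphism $\alpha:A\to B$ (here $\alpha=e^\flat$ or $s^\flat$), an element $b\in B$ is closed relative to $\alpha$ if it is a meet in $B$ of elements of $\alpha[A]$, and open relative to $\alpha$ if it is a join in $B$ of elements of $\alpha[A]$. The conditions on $\alpha$ are as follows (they are equivalent to each other for every such $e^\flat$): (T) for all closed $f$ and open $g$ in $B$ with $f\le g$ there are countable families $\{a_n\},\{b_n\}\subseteq A$ with $f \le \bigwedge_n \alpha(a_n) \le \bigvee_n \alpha(b_n) \le g$; (BS) for all closed $f$ and open $g$ in $B$ with $f\le g$ there are countable families $\{a_n\},\{b_n\}\subseteq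 A$ with $f \le \bigvee_n \alpha(a_n) \le \bigwedge_n \alpha(b_n) \le g$; (S) for all closed $f$ and open $g$ in $B$ with $f\le g$ there are countable families $\{a_n\},\{b_n\}\subseteq A$ with $f \le \bigwedge_n \alpha(a_n) = \bigvee_n \alpha(b_n) \le g$. Joins and meets are taken in $B$ and are presupposed to exist. *)

(* Defs.v *)
From HB Require Import structures.
From mathcomp Require Import all_boot all_order all_algebra.
From mathcomp Require Import all_classical all_reals all_analysis.

Set Implicit Arguments.
Unset Strict Implicit.
Unset Printing Implicit Defensive.

Import Order.TTheory GRing.Theory Num.Theory.
Import numFieldNormedType.Exports.
Local Open Scope classical_set_scope.
Local Open Scope ring_scope.

(** Only the order of the codomain enters the following notions, so they are
    defined for an arbitrary map [alpha] into a partially ordered type.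
    [infimums S u] (resp. [supremums S u]) says that the meet (resp. join) of
    [S] exists and is [u].  Countable families are sequences: repetitions cover
    the finite ones. *)
Section Conditions.
Context {A : Type} {d : Order.disp_t} {B : porderType d}.
Variable alpha : A -> B.

Definition closed_rel (b : B) : Prop :=
  exists S : set A, infimums (alpha @` S) b.

Definition open_rel (b : B) : Prop :=
  exists S : set A, supremums (alpha @` S) b.

Definition cond_T : Prop :=
  forall f g : B, closed_rel f -> open_rel g -> (f <= g)%O ->
  exists (a b : nat -> A) (u v : B),
    [/\ infimums (range (alpha \o a)) u, supremums (range (alpha \o b)) v,
        (f <= u)%O, (u <= v)%O & (v <= g)%O].

Definition cond_BS : Prop :=
  forall f g : B, closed_rel f -> open_rel g -> (f <= g)%O ->
  exists (a b : nat -> A) (u v : B),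
    [/\ supremums (range (alpha \o a)) u, infimums (range (alpha \o b)) v,
        (f <= u)%O, (u <= v)%O & (v <= g)%O].

Definition cond_S : Prop :=
  forall f g : B, closed_rel f -> open_rel g -> (f <= g)%O ->
  exists (a b : nat -> A) (u : B),
    [/\ infimums (range (alpha \o a)) u, supremums (range (alpha \o b)) u,
        (f <= u)%O & (u <= g)%O].

End Conditions.

Section BoundedFunctions.
Context (X : Type) (R : realType).

Definition bfun : Type := set_type (bounded_fun : set (X -> R)).

HB.instance Definition _ := SubChoice.on bfun.
(* the order induced by the pointwise order of [X -> R], cf. [lefP] *)
HB.instance Definition _ := [SubChoice_isSubPOrder of bfun by <:
  with FunOrder.fun_display].

Lemma bfun_leP (f g : bfun) : (f <= g)%O <-> forall x, val f x <= val g x.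
Proof. by rewrite -Order.le_val; split => /lefP. Qed.

End BoundedFunctions.

Definition is_embedding {X Y : topologicalType} (e : X -> Y) : Prop :=
  [/\ continuous e, injective e &
      forall U : set X, open U -> exists2 V : set Y, open V & e @^-1` V = U].

Record compactification (X : topologicalType) := Compactification {
  cpt_space :> topologicalType;
  cpt_map : X -> cpt_space;
  cpt_compact : compact [set: cpt_space];
  cpt_hausdorff : hausdorff_space cpt_space;
  cpt_embedding : is_embedding cpt_map;
  cpt_dense : dense (range cpt_map)
}.

Section BasicExtension.
Context (R : realType) (X : topologicalType) (e : compactification X).

Lemma basic_ext_subproof (f : continuousType e R) :
  f \o cpt_map e \in (bounded_fun : set (X -> R)).
Proof.
have cf : {within [set: e], continuous f}.
  by apply: continuous_subspaceT => x; exact: cts_fun.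
have := compact_bounded (continuous_compact cf (@cpt_compact _ e)).
rewrite inE /= /bounded_near /globally /=.
by apply: filterS => M + x _; apply => /=; exists (cpt_map e x).
Qed.

Definition basic_ext (f : continuousType e R) : bfun X R :=
  exist _ (f \o cpt_map e) (basic_ext_subproof f).

End BasicExtension.
Arguments basic_ext R {X} e f.

(** [beta X] is any compactification with the universal property; it is unique
    up to a unique homeomorphism under [X]. *)
Definition is_stone_cech (X : topologicalType) (s : compactification X) : Prop :=
  forall K : topologicalType, compact [set: K] -> hausdorff_space K ->
  forall f : X -> K, continuous f ->
  exists! g : continuousType s K, g \o cpt_map s = f.

(* Main.v *)
Require Import Defs.
From HB Require Import structures.
From mathcomp Require Import all_boot all_order all_algebra.
From mathcomp Require Import all_classical all_reals all_analysis.
From mathcomp Require Import lra.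

(** Meets and joins in [B(X)] are pointwise, and by Urysohn's lemma in the
    compactification the closed (open) elements relative to [basic_ext] are
    exactly the bounded upper (lower) semicontinuous functions.

    If [C] and [D] are disjoint closed sets, the conditions applied to the
    indicators of [C] and of the complement of [D] give sequences [a], [b] of
    continuous functions such that the sets [1/2 < b n] cover [C] with closures
    missing [D], and the sets [a n < 1/2] cover [D] with closures missing [C];
    countable covers of this kind yield disjoint open neighbourhoods.

    Conversely, if [X] is normal, the Katetov-Tong theorem inserts a bounded
    continuous function between [f] and [g], which extends to the Stone-Cech
    compactification, so constant sequences suffice. *)

Set Implicit Arguments.
Unset Strict Implicit.
Unset Printing Implicit Defensive.

Section NormalityInsertion.
Import Order.TTheory GRing.Theory Num.Theory.
Import numFieldNormedType.Exports.
Local Open Scope classical_set_scope.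
Local Open Scope ring_scope.

(** * Compact and Hausdorff subspaces as types *)

Section SetType.
Context {T : topologicalType} (A : set T).

Lemma hausdorff_set_type : hausdorff_space T -> hausdorff_space (set_type A).
Proof.
move=> hT p q pq; apply/val_inj/hT => U V pU qV.
have [r [rU rV]] := pq (val @^-1` U) (val @^-1` V)
  (initial_continuous pU) (initial_continuous qV).
by exists (val r).
Qed.

(** A filter on the subspace is pushed forward along [val]; a cluster point of the image lying in
    [A] is also one in the subspace, whose open sets are traces of open sets of [T]. *)
Lemma compact_set_type : compact A -> compact [set: set_type A].
Proof.
move=> cA F FF _.
have FA : (val @ F) A.
  by apply: (@filterS _ F _ setT) => [x _|]; [exact: set_valP|exact: filterT].
have [p [Ap pF]] := cA (val @ F) _ FA.
exists (exist _ p (mem_set Ap)); split=> // B V FB [W [[U oU <-] /= pU UV]].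
have [_ [[b Bb <-] Ub]] : val @` B `&` U !=set0.
  by apply: pF; [apply: (@filterS _ F _ B) FB => b Bb; exists b|
    exact: open_nbhs_nbhs].
by exists b; split=> //; exact: UV.
Qed.

End SetType.

(** * Semicontinuity and Katetov-Tong insertion *)

Section Semicontinuity.
Context {X : topologicalType} {R : realType}.
Implicit Types f g h : X -> R.

Definition usc f := forall c, open [set x | f x < c].
Definition lsc f := forall c, open [set x | c < f x].

Lemma continuous_usc_lsc f : continuous f <-> usc f /\ lsc f.
Proof.
split=> [/continuousP cf|[uf lf] x].
  by split=> c; [exact: (cf _ (@open_lt _ c))|exact: (cf _ (@open_gt _ c))].
apply/cvgrPdist_lt => e e0; near=> y; rewrite ltr_distlC; apply/andP; split.
  near: y; apply: (open_nbhs_nbhs (conj (lf (f x - e)) _)) => /=; lra.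
near: y; apply: (open_nbhs_nbhs (conj (uf (f x + e)) _)) => /=; lra.
Unshelve. all: by end_near. Qed.

Lemma closed_usc f c : usc f -> closed [set x | c <= f x].
Proof.
move=> uf; rewrite [X in closed X](_ : _ = ~` [set x | f x < c]).
  exact: open_closedC.
by apply/seteqP; split=> x /=; rewrite leNgt => /negP.
Qed.

Lemma closed_lsc f c : lsc f -> closed [set x | f x <= c].
Proof.
move=> lf; rewrite [X in closed X](_ : _ = ~` [set x | c < f x]).
  exact: open_closedC.
by apply/seteqP; split=> x /=; rewrite leNgt => /negP.
Qed.

Lemma usc_max f g : usc f -> usc g -> usc (f \max g).
Proof.
move=> uf ug c.
rewrite (_ : [set x | _] = [set x | f x < c] `&` [set x | g x < c]).
  exact: openI.
by apply/seteqP; split=> x /=; rewrite gt_max => /andP.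
Qed.

Lemma lsc_min f g : lsc f -> lsc g -> lsc (f \min g).
Proof.
move=> lf lg c.
rewrite (_ : [set x | _] = [set x | c < f x] `&` [set x | c < g x]).
  exact: openI.
by apply/seteqP; split=> x /=; rewrite lt_min => /andP.
Qed.

Lemma usc_indic (A : set X) : closed A -> usc (\1_A).
Proof.
move=> cA c; have [c0|c0] := leP c 0.
  rewrite (_ : [set x | _] = set0); first exact: open0.
  apply/seteqP; split=> x //=; rewrite indicE; case: (_ \in _) => /=; lra.
have [c1|c1] := leP c 1.
  rewrite (_ : [set x | _] = ~` A); first exact: closed_openC.
  apply/seteqP; split=> x /=; rewrite indicE.
    by move=> /[swap] /mem_set ->; rewrite ltNge c1.
  by move=> nAx; rewrite memNset.
rewrite (_ : [set x | _] = setT); first exact: openT.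
apply/seteqP; split=> x //= _; rewrite indicE; case: (_ \in _) => /=; lra.
Qed.

(** The indicator of [A] is 1 minus that of its complement. *)
Lemma lsc_indic (A : set X) : open A -> lsc (\1_A).
Proof.
move=> oA c; have := usc_indic (open_closedC oA) (1 - c); congr open.
by apply/seteqP; split=> x /=; rewrite !indicE in_setC;
  case: (_ \in _) => /=; lra.
Qed.

(* Climbing in steps of height [e], [h] is the maximum of Urysohn functions
   separating the sublevel [g <= t - e] from the superlevel [t <= f]. *)
Lemma usc_lsc_approx f g (m e : R) (N : nat) : normal_space X ->
  usc f -> lsc g -> (forall x, f x <= g x) -> (forall x, m <= g x) -> 0 < e ->
  exists2 h, continuous h & forall x,
    h x <= g x + e /\ (f x <= m + N%:R * e -> f x - e <= h x).
Proof.
move=> nX uf lg fg mg e0; elim: N => [|N [h ch hP]].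
  exists (cst m) => [x|x]; first exact: cst_continuous.
  by have := mg x; rewrite /cst/=; split; lra.
pose t := m + N%:R * e.
(* The low value [m - 1] is below every [g x] and strictly below [t], even for [N = 0], where
   [t = m]. *)
have [||||u [cu uA uB urange]] := @urysohn_ext_itv X R nX
  [set x | g x <= t - e] [set x | t <= f x] (m - 1) t.
- exact: closed_lsc.
- exact: closed_usc.
- rewrite -subset0 => x [/= gx fx]; have := fg x; lra.
- have : 0 <= N%:R * e by rewrite mulr_ge0// ltW.
  rewrite /t; lra.
exists (h \max u) => [x|x]; first exact: (continuous_max (ch x) (cu x)).
have [hg fh] := hP x; rewrite /= ge_max le_max hg/=; split.
  have [gx|gx] := leP (g x) (t - e).
    have -> : u x = m - 1 by apply: uA; exists x.
    by have := mg x; lra.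
  have : u x \in `[m - 1, t] by apply: urange; exists x.
  by rewrite in_itv/= => /andP[_]; lra.
move=> fN; have [/fh ->//|tf] := leP (f x) t.
have -> : u x = t by apply: uB; exists x => //=; exact: ltW.
by apply/orP; right; move: fN; rewrite -natr1 /t; lra.
Qed.

(** A continuous [h] with [f - e/2 <= h <= g + e/2] is thickened to the band from [h - e/2] to
    [h + e/2], of width [e], which is then intersected with the band from [f] to [g]. *)
Lemma usc_lsc_shrink f g (m M e : R) : normal_space X ->
  usc f -> lsc g -> (forall x, [/\ m <= f x, f x <= g x & g x <= M]) -> 0 < e ->
  exists f' g' : X -> R, [/\ usc f', lsc g' & forall x,
    [/\ f x <= f' x, f' x <= g' x, g' x <= g x & g' x <= f' x + e]].
Proof.
move=> nX uf lg fgP e0; have e20 : 0 < e / 2 by lra.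
(* [N] steps of height [e / 2] climb from [m] past [M], so the lower estimate on [h] holds
   everywhere. The absolute value covers an empty [X], where [m <= M] may fail. *)
pose N := Num.bound (`|M - m| / (e / 2)).
have MN : M <= m + N%:R * (e / 2).
  have : `|M - m| / (e / 2) < N%:R by rewrite archi_boundP// divr_ge0// ltW.
  by rewrite ltr_pdivrMr//; have := ler_norm (M - m); lra.
have [||//|h ch hP] := @usc_lsc_approx f g m (e / 2) N nX uf lg.
- by move=> x; have [] := fgP x.
- by move=> x; have [mf fg _] := fgP x; exact: le_trans fg.
have [uh lh] : usc (fun x => h x - e / 2) /\ lsc (fun x => h x + e / 2).
  split; apply continuous_usc_lsc => x.
    by apply: cvgB; [exact: ch|exact: cvg_cst].
  by apply: cvgD; [exact: ch|exact: cvg_cst].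
exists (f \max (fun x => h x - e / 2)), (g \min (fun x => h x + e / 2)).
split; [exact: usc_max|exact: lsc_min|move=> x /=].
have [fx gx gM] := fgP x; have [hg fh] := hP x.
have {}fh : f x - e / 2 <= h x by apply: fh; lra.
rewrite /Num.min /Num.max; case: ifPn; case: ifPn; rewrite -?leNgt; split; lra.
Qed.

Lemma katetov_tong f g (m M : R) : normal_space X ->
  usc f -> lsc g -> (forall x, [/\ m <= f x, f x <= g x & g x <= M]) ->
  exists2 h, continuous h & forall x, f x <= h x <= g x.
Proof.
move=> nX uf lg fgP.
(* Iterated shrinking makes [F n] increase and [G n] decrease with a gap tending
   to 0; their common limit inherits semicontinuity from both sides. *)
pose V := {p : (X -> R) * (X -> R) | [/\ usc p.1, lsc p.2 &
  forall x, [/\ m <= p.1 x, p.1 x <= p.2 x & p.2 x <= M]]}.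
(* The stage number is paired with the state so that the tolerance can shrink with it. *)
have stepP (np : nat * V) : exists q : V, forall x,
    [/\ (sval np.2).1 x <= (sval q).1 x, (sval q).2 x <= (sval np.2).2 x &
     (sval q).2 x <= (sval q).1 x + np.1.+1%:R^-1].
  case: np => n [[f1 g1] [/= uf1 lg1 fg1]].
  have n0 : 0 < n.+1%:R^-1 :> R by rewrite invr_gt0.
  have [f2 [g2 [uf2 lg2 fg2]]] := usc_lsc_shrink nX uf1 lg1 fg1 n0.
  have P2 : [/\ usc f2, lsc g2 &
      forall x, [/\ m <= f2 x, f2 x <= g2 x & g2 x <= M]].
    by split=> // x; have [? ? ?] := fg1 x; have [? ? ? ?] := fg2 x; split; lra.
  by exists (exist _ (f2, g2) P2) => x /=; have [] := fg2 x.
have [step {}stepP] := choice stepP.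
pose p := fix p n : V :=
  if n is n'.+1 then step (n', p n') else exist _ (f, g) (And3 uf lg fgP).
pose F n := (sval (p n)).1; pose G n := (sval (p n)).2.
have uF n : usc (F n) by have [] := svalP (p n).
have lG n : lsc (G n) by have [] := svalP (p n).
have FG n x : F n x <= G n x by have [_ _ /(_ x)[]] := svalP (p n).
have Fmono x : {homo F^~ x : k n / (k <= n)%N >-> k <= n}.
  by apply/nondecreasing_seqP => n; have [] := stepP (n, p n) x.
have Gmono x : {homo G^~ x : k n / (k <= n)%N >-> n <= k}.
  by apply/nonincreasing_seqP => n; have [] := stepP (n, p n) x.
have gap n x : G n.+1 x <= F n.+1 x + n.+1%:R^-1.
  by have [] := stepP (n, p n) x.
have FGx k n x : F k x <= G n x.
  by rewrite (le_trans (Fmono x _ _ (leq_maxl k n)))// (le_trans (FG _ x))//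
    Gmono// leq_maxr.
pose h x := sup (range (F^~ x)).
have Fh n x : F n x <= h x.
  by apply: ub_le_sup; [exists (G 0%N x) => _ [k _ <-]|exists n].
have hG n x : h x <= G n x.
  by apply: ge_sup; [exists (F 0%N x); exists 0%N|move=> _ [k _ <-]].
exists h; last by move=> x; rewrite (Fh 0%N x) (hG 0%N x).
apply/continuous_usc_lsc; split=> c.
  (* A supremum of upper semicontinuous functions need not be upper semicontinuous; here the gap
     bounds [h] by [F n.+1 + n.+1%:R^-1], which keeps this union inside [h < c]. *)
  rewrite (_ : [set x | _] = \bigcup_n [set x | F n.+1 x < c - n.+1%:R^-1]).
    by apply: bigcup_open => n _; exact: uF.
  apply/seteqP; split=> x /=.
    move=> /ltr_add_invr[n hc]; exists n => //=.
    by rewrite ltrBrDr (le_lt_trans _ hc)// lerD2r.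
  move=> [n _ /=]; rewrite ltrBrDr; apply: le_lt_trans.
  exact: le_trans (gap n x).
rewrite (_ : [set x | _] = \bigcup_n [set x | c + n.+1%:R^-1 < G n.+1 x]).
  by apply: bigcup_open => n _; exact: lG.
apply/seteqP; split=> x /=.
  move=> /ltr_add_invr[n hc]; exists n => //=.
  exact: lt_le_trans (hG _ _).
move=> [n _ /=] cG; rewrite -(ltrD2r n.+1%:R^-1) (lt_le_trans cG)//.
by rewrite (le_trans (gap n x))// lerD2r.
Qed.

End Semicontinuity.

(** * Separation by countable open covers *)

Lemma countable_separation {X : topologicalType} (A B : set X)
    (U V : nat -> set X) :
  (forall n, open (U n)) -> (forall n, open (V n)) ->
  A `<=` \bigcup_n U n -> B `<=` \bigcup_n V n ->
  (forall n, closure (U n) `&` B = set0) ->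
  (forall n, closure (V n) `&` A = set0) ->
  exists U' V', [/\ open U', open V', A `<=` U', B `<=` V' & U' `&` V' = set0].
Proof.
(* Removing from [P n] the closures of [Q 0], ..., [Q n] keeps the cover and
   makes the two unions disjoint. *)
pose E (P Q : nat -> set X) :=
  \bigcup_n (P n `&` ~` \bigcup_(k in `I_n.+1) closure (Q k)).
have oE P Q : (forall n, open (P n)) -> open (E P Q).
  move=> oP; apply: bigcup_open => n _; apply: openI => //; apply: closed_openC.
  by apply: closed_bigcup => // k _; exact: closed_closure.
have sE C P Q : C `<=` \bigcup_n P n ->
    (forall n, closure (Q n) `&` C = set0) -> C `<=` E P Q.
  move=> CP QC x Cx; have [n _ Px] := CP x Cx.
  exists n => //; split=> // -[k _ Qx].
  by have : (closure (Q k) `&` C) x by []; rewrite QC.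
move=> oU oV AU BV UB VA; exists (E U V), (E V U).
split; [exact: oE|exact: oE|exact: sE|exact: sE|].
rewrite -subset0 => x [[n _ [Ux nVx]] [m _ [Vx nUx]]].
have [mn|nm] := leqP m n.
  by apply: nVx; exists m => //; exact: subset_closure.
by apply: nUx; exists n; [rewrite /= ltnS ltnW|exact: subset_closure].
Qed.

(** * Meets and joins of bounded functions *)

Section BoundedFunctions.
Context {X : Type} {R : realType}.
Implicit Types (S : set (bfun X R)) (b : bfun X R).

Lemma bfun_bound b : exists M, forall x, `|val b x| <= M.
Proof.
have /set_mem/pinfty_ex_gt0[M _ bM] := valP b.
by exists M => x; exact: bM.
Qed.

Lemma mem_bounded_fun (f : X -> R) (M : R) : (forall x, `|f x| <= M) ->
  f \in (bounded_fun : set (X -> R)).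
Proof.
move=> fM; rewrite inE /= /bounded_near; near=> N => x _ /=.
rewrite (le_trans (fM x))//.
Unshelve. all: by end_near. Qed.

(** Comparison with such one-point changes shows that meets and joins are pointwise. *)
Lemma bfun_update b x (c : R) :
  exists b' : bfun X R, val b' x = c /\ forall y, y <> x -> val b' y = val b y.
Proof.
have [M bM] := bfun_bound b.
pose f y := if `[< y = x >] then c else val b y.
have fM y : `|f y| <= Num.max M `|c|.
  by rewrite /f le_max; case: asboolP; rewrite ?lexx ?orbT ?bM.
exists (exist _ f (mem_bounded_fun fM)); rewrite /= /f; split=> [|y yx].
  by case: asboolP.
by case: asboolP.
Qed.

(** If no member of [S] went below [c] at [x], raising [b] to [c] at that single point would give a
    lower bound of [S] that is not below [b]. *)
Lemma infimums_bfunP S b : infimums S b <->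
  lbound S b /\
  forall x c, val b x < c -> exists2 s, S s & val s x < c.
Proof.
split=> [[bS bmax]|[bS bapprox]]; split=> //.
  move=> x c bc; apply: contrapT => nS.
  have [b' [b'x b'E]] := bfun_update b x c.
  suff : lbound S b' by move=> /bmax/bfun_leP/(_ x); rewrite b'x leNgt bc.
  move=> s Ss; apply/bfun_leP => y.
  have [->|yx] := pselect (y = x).
    by rewrite b'x leNgt; apply/negP => sc; apply: nS; exists s.
  by rewrite b'E//; have /bfun_leP := bS _ Ss; exact.
move=> b' b'S; apply/bfun_leP => x; rewrite leNgt.
apply/negP => /bapprox[s /b'S].
by move=> /bfun_leP/(_ x); rewrite leNgt => /negP.
Qed.

Lemma supremums_bfunP S b : supremums S b <->
  ubound S b /\
  forall x c, c < val b x -> exists2 s, S s & c < val s x.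
Proof.
split=> [[bS bmin]|[bS bapprox]]; split=> //.
  move=> x c bc; apply: contrapT => nS.
  have [b' [b'x b'E]] := bfun_update b x c.
  suff : ubound S b' by move=> /bmin/bfun_leP/(_ x); rewrite b'x leNgt bc.
  move=> s Ss; apply/bfun_leP => y.
  have [->|yx] := pselect (y = x).
    by rewrite b'x leNgt; apply/negP => sc; apply: nS; exists s.
  by rewrite b'E//; have /bfun_leP := bS _ Ss; exact.
move=> b' b'S; apply/bfun_leP => x; rewrite leNgt.
apply/negP => /bapprox[s /b'S].
by move=> /bfun_leP/(_ x); rewrite leNgt => /negP.
Qed.

End BoundedFunctions.

(** * Closed and open elements as semicontinuous functions *)

Section BasicExtension.
Context {X : topologicalType} {R : realType} (e : compactification X).
Implicit Types b : bfun X R.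

Lemma continuous_basic_ext (a : continuousType e R) :
  continuous (val (basic_ext R e a)).
Proof.
have [ce _ _] := cpt_embedding e.
by move=> x; apply: continuous_comp; [exact: ce|exact: cts_fun].
Qed.

(** Urysohn's lemma is applied in the compactification, normal as a compact Hausdorff space, to the
    image of [x] and the complement of an open set with trace [U]. *)
Lemma cpt_separation (U : set X) (x : X) (c d : R) : open U -> U x -> c < d ->
  exists a : continuousType e R,
    [/\ a (cpt_map e x) = c, forall y, c <= a (cpt_map e y) <= d &
        forall y, ~ U y -> a (cpt_map e y) = d].
Proof.
move=> oU Ux cd; have [_ _ /(_ U oU)[V oV VU]] := cpt_embedding e.
have nY := compact_normal (@cpt_hausdorff _ e) (@cpt_compact _ e).
have [|||//|h [ch h1 h2 hr]] := @urysohn_ext_itv e R nY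
    [set cpt_map e x] (~` V) c d.
- exact/accessible_closed_set1/hausdorff_accessible/cpt_hausdorff.
- exact: open_closedC.
- by rewrite -subset0 => _ [->]; apply; rewrite -VU in Ux.
pose a : continuousType e R := HB.pack h (isContinuous.Build _ _ h ch).
exists a; split=> [|y|y nUy].
- by apply: h1; exists (cpt_map e x).
- have := hr (h (cpt_map e y)); rewrite /= in_itv/=; apply.
  by exists (cpt_map e y).
- by apply: h2; exists (cpt_map e y) => //; rewrite -VU in nUy.
Qed.

(** A pointwise meet of continuous functions is upper semicontinuous; conversely [b] is the meet of
    all extendable functions above it. *)
Lemma closed_relP b : closed_rel (basic_ext R e) b <-> usc (val b).
Proof.
split=> [[S /infimums_bfunP[bS bapprox]] c|ub].
  rewrite (_ : [set x | _] =
      \bigcup_(a in S) [set x | val (basic_ext R e a) x < c]).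
    apply: bigcup_open => a _.
    by have /continuous_usc_lsc[] := @continuous_basic_ext a.
  apply/seteqP; split=> [x /= /bapprox[_ [a Sa <-] ac]|x [a Sa] /=].
    by exists a.
  by have /bfun_leP/(_ x) := bS _ (imageP _ Sa); exact: le_lt_trans.
exists [set a | (b <= basic_ext R e a)%O]; apply/infimums_bfunP.
split=> [_ [a ba <-]//|x c bc].
have [M bM] := bfun_bound b.
(* The midpoint leaves room on both sides: [b < c'] near [x], and the value [c'] at [x] is still
   below [c]. *)
pose c' := (val b x + c) / 2.
have bc' : val b x < c' by rewrite /c'; lra.
(* The high value exceeds [c'] and dominates [b] everywhere. *)
have [|a [ax ar aU]] :=
  cpt_separation (x := x) (ub c') bc' (_ : c' < Num.max c' M + 1).
  by rewrite (le_lt_trans (y := Num.max c' M)) ?le_max ?lexx// ltrDl.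
exists (basic_ext R e a); last by rewrite /= ax /c'; lra.
exists a => //=; apply/bfun_leP => y /=.
have [yc|cy] := ltP (val b y) c'.
  by have /andP[+ _] := ar y; apply: le_trans; exact: ltW.
rewrite aU; last by rewrite /= ltNge cy.
rewrite (le_trans (ler_norm _))// (le_trans (bM y))//.
by rewrite (le_trans (y := Num.max c' M)) ?le_max ?lexx ?orbT// lerDl.
Qed.

Lemma open_relP b : open_rel (basic_ext R e) b <-> lsc (val b).
Proof.
split=> [[S /supremums_bfunP[bS bapprox]] c|lb].
  rewrite (_ : [set x | _] =
      \bigcup_(a in S) [set x | c < val (basic_ext R e a) x]).
    apply: bigcup_open => a _.
    by have /continuous_usc_lsc[] := @continuous_basic_ext a.
  apply/seteqP; split=> [x /= /bapprox[_ [a Sa <-] ac]|x [a Sa] /=].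
    by exists a.
  by have /bfun_leP/(_ x)/[swap] := bS _ (imageP _ Sa); exact: lt_le_trans.
exists [set a | (basic_ext R e a <= b)%O]; apply/supremums_bfunP.
split=> [_ [a ba <-]//|x c bc].
have [M bM] := bfun_bound b.
pose c' := (val b x + c) / 2.
have bc' : c' < val b x by rewrite /c'; lra.
have [|a [ax ar aU]] :=
  cpt_separation (x := x) (lb c') bc' (_ : - c' < Num.max (- c') M + 1).
  by rewrite (le_lt_trans (y := Num.max (- c') M)) ?le_max ?lexx// ltrDl.
(* [a] equals [- c'] at [x], is at least [- c'] everywhere, and exceeds [M] where [b <= c']; hence
   its negative lies below [b]. *)
pose a' : continuousType e R := HB.pack (fun y => - a y)
  (isContinuous.Build _ _ _ (fun y => cvgN (@cts_fun _ _ a y))).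
exists (basic_ext R e a'); last by rewrite /= ax /c'; lra.
exists a' => //=; apply/bfun_leP => y /=; rewrite lerNl.
have [cy|yc] := ltP c' (val b y).
  by have /andP[+ _] := ar y; apply: le_trans; rewrite lerN2 ltW.
rewrite aU; last by rewrite /= ltNge yc.
rewrite (le_trans (ler_norm _))// normrN (le_trans (bM y))//.
by rewrite (le_trans (y := Num.max (- c') M)) ?le_max ?lexx ?orbT// lerDl.
Qed.

End BasicExtension.

(** * Comparison of the three conditions *)

Section Insertion.
Context {A : Type} {d : Order.disp_t} {B : porderType d} (alpha : A -> B).

Lemma cond_S_T_BS : cond_S alpha -> cond_T alpha /\ cond_BS alpha.
Proof.
move=> cS; split=> f g cf og fg;
  have [a [b [u [iu su fu ug]]]] := cS f g cf og fg.
  by exists a, b, u, u.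
by exists b, a, u, u.
Qed.

(** This common consequence forgets the order between [u] and [v], so one argument for normality
    serves all three conditions. *)
Lemma cond_sequences : cond_T alpha \/ cond_BS alpha \/ cond_S alpha ->
  forall f g : B, closed_rel alpha f -> open_rel alpha g -> (f <= g)%O ->
  exists (a b : nat -> A) (u v : B),
    [/\ infimums (range (alpha \o a)) u, supremums (range (alpha \o b)) v,
        (f <= u)%O /\ (u <= g)%O & (f <= v)%O /\ (v <= g)%O].
Proof.
move=> [cT|[cBS|/cond_S_T_BS[cT _]]] f g cf og fg.
- have [a [b [u [v [iu sv fu uv vg]]]]] := cT f g cf og fg.
  by exists a, b, u, v; split=> //; split=> //;
    [exact: le_trans uv vg|exact: le_trans fu uv].
- have [a [b [u [v [su iv fu uv vg]]]]] := cBS f g cf og fg.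
  by exists b, a, v, u; split=> //; split=> //;
    [exact: le_trans fu uv|exact: le_trans uv vg].
- have [a [b [u [v [iu sv fu uv vg]]]]] := cT f g cf og fg.
  by exists a, b, u, v; split=> //; split=> //;
    [exact: le_trans uv vg|exact: le_trans fu uv].
Qed.

End Insertion.

(** * Normality and the conditions on the basic extension *)

Section Normality.
Context {X : topologicalType} {R : realType}.

Lemma cond_normal (e : compactification X) :
  cond_T (basic_ext R e) \/ cond_BS (basic_ext R e) \/ cond_S (basic_ext R e) ->
  normal_space X.
Proof.
move=> /cond_sequences ins; apply/(@normal_openP R) => C D cC cD CD0.
have indic1 (A : set X) (x : X) : `|\1_A x| <= 1 :> R.
  by rewrite indicE; case: (_ \in _); rewrite ?normr1 ?normr0.
pose f : bfun X R := exist _ \1_C (mem_bounded_fun (indic1 C)).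
pose g : bfun X R := exist _ \1_(~` D) (mem_bounded_fun (indic1 (~` D))).
have fC x : C x -> val f x = 1 by move=> Cx; rewrite /= indicE mem_set.
have gD x : D x -> val g x = 0.
  by move=> Dx; rewrite /= indicE memNset//= => /(_ Dx).
have [|||a [b [u [v [iu sv [fu ug] [fv vg]]]]]] := ins f g.
- exact/closed_relP/usc_indic.
- exact/open_relP/lsc_indic/closed_openC.
- apply/bfun_leP => x /=; rewrite !indicE in_setC.
  have [xC|] := boolP (x \in C); last by rewrite ler0n.
  rewrite (_ : x \in D = false)//; apply/negP => /set_mem Dx.
  by rewrite -[False]/(set0 x) -CD0; split=> //; exact: set_mem.
have [al ainf] := (infimums_bfunP _ _).1 iu.
have [bu bsup] := (supremums_bfunP _ _).1 sv.
(* The level 1/2 separates the values 1 of [f] on [C] and 0 of [g] on [D]. *)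
pose U n := [set x | 2^-1 < val (basic_ext R e (b n)) x].
pose V n := [set x | val (basic_ext R e (a n)) x < 2^-1].
have a_usc_lsc n : usc _ /\ lsc _ :=
  (continuous_usc_lsc _).1 (@continuous_basic_ext X R e (a n)).
have b_usc_lsc n : usc _ /\ lsc _ :=
  (continuous_usc_lsc _).1 (@continuous_basic_ext X R e (b n)).
apply: (@countable_separation _ _ _ U V).
- by move=> n; exact: (b_usc_lsc n).2.
- by move=> n; exact: (a_usc_lsc n).1.
- move=> x Cx; have [|_ [n _ <-] bn] := bsup x 2^-1; last by exists n.
  by have /bfun_leP/(_ x) := fv; rewrite fC//; lra.
- move=> x Dx; have [|_ [n _ <-] an] := ainf x 2^-1; last by exists n.
  by have /bfun_leP/(_ x) := ug; rewrite gD//; lra.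
(* The closure of [U n] stays in the region where [b n] is at least 1/2, while [b n <= v <= g = 0]
   on [D]. *)
- move=> n; rewrite -subset0 => x [+ Dx].
  have : closure (U n) `<=` [set x | 2^-1 <= val (basic_ext R e (b n)) x].
    rewrite [X in _ `<=` X](closure_id _).1; last first.
      exact: closed_usc (b_usc_lsc n).1.
    by apply: closureS => y /ltW.
  move=> /[apply] /=.
  have /bfun_leP/(_ x) := bu _ (imageT _ n); have /bfun_leP/(_ x) := vg.
  by rewrite gD//=; lra.
- move=> n; rewrite -subset0 => x [+ Cx].
  have : closure (V n) `<=` [set x | val (basic_ext R e (a n)) x <= 2^-1].
    rewrite [X in _ `<=` X](closure_id _).1; last first.
      exact: closed_lsc (a_usc_lsc n).2.
    by apply: closureS => y /ltW.
  move=> /[apply] /=.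
  have /bfun_leP/(_ x) := al _ (imageT _ n); have /bfun_leP/(_ x) := fu.
  by rewrite fC//=; lra.
Qed.

(** The universal property concerns compact targets, so [h] is corestricted to the segment from
    [- M] to [M], extended there, and composed with the inclusion into [R]. *)
Lemma stone_cech_extension (s : compactification X) (h : X -> R) (M : R) :
  is_stone_cech s -> continuous h -> (forall x, `|h x| <= M) ->
  exists a : continuousType s R, a \o cpt_map s = h.
Proof.
move=> sc ch hM; pose K := set_type `[- M, M]%classic.
have hK x : h x \in `[- M, M]%classic.
  by rewrite inE/= in_itv/= -ler_norml.
pose k x : K := exist _ (h x) (hK x).
have ck : continuous k.
  apply/continuousP => _ [U oU <-].
  by move/continuousP : ch; apply.
have [g [gk _]] := sc K (compact_set_type (@segment_compact _ (- M) M))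
  (hausdorff_set_type (@Rhausdorff R)) k ck.
have cg : continuous (val \o g : s -> R).
  move=> x; apply: continuous_comp; first exact: cts_fun.
  exact: initial_continuous.
pose a : continuousType s R := HB.pack (val \o g : s -> R)
  (isContinuous.Build _ _ _ cg).
exists a.
by apply/funext => x /=; rewrite -[g _]/((g \o cpt_map s) x) gk.
Qed.

Lemma normal_cond_S (s : compactification X) : is_stone_cech s ->
  normal_space X -> cond_S (basic_ext R s).
Proof.
move=> sc nX f g /closed_relP uf /open_relP lg /bfun_leP fg.
have [m fm] := bfun_bound f; have [M gM] := bfun_bound g.
have [x|h ch fhg] := @katetov_tong X R (val f) (val g) (- m) M nX uf lg.
  split=> //; first by have := fm x; rewrite ler_norml => /andP[].
  by have := gM x; rewrite ler_norml => /andP[].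
have hM x : `|h x| <= Num.max m M.
  have /andP[fh hg] := fhg x; have := fm x; have := gM x.
  rewrite !ler_norml => /andP[_ gM'] /andP[fm' _].
  rewrite lerNl !le_max; apply/andP; split; apply/orP; [left|right]; lra.
have [a ah] := stone_cech_extension sc ch hM.
have vh x : val (basic_ext R s a) x = h x by rewrite -ah.
(* The range of a constant sequence is a singleton, whose meet and join are its only element. *)
exists (fun=> a), (fun=> a), (basic_ext R s a); split.
- by split=> [_ [_ _ <-]//|b]; apply; exists 0%N.
- by split=> [_ [_ _ <-]//|b]; apply; exists 0%N.
- by apply/bfun_leP => x; rewrite vh; have /andP[] := fhg x.
- by apply/bfun_leP => x; rewrite vh; have /andP[] := fhg x.
Qed.

End Normality.
End NormalityInsertion.

Theorem theorem3p8 (R : realType) (X : topologicalType)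
    (X_crs : completely_regular_space X) (X_T2 : hausdorff_space X) :
  [/\ forall e : compactification X,
        cond_T (basic_ext R e) \/ cond_BS (basic_ext R e)
          \/ cond_S (basic_ext R e) ->
        normal_space X,
      forall s : compactification X, is_stone_cech s ->
        normal_space X ->
        [/\ cond_T (basic_ext R s), cond_BS (basic_ext R s)
          & cond_S (basic_ext R s)]
    & forall s : compactification X, is_stone_cech s ->
        normal_space X <->
        [/\ cond_T (basic_ext R s), cond_BS (basic_ext R s)
          & cond_S (basic_ext R s)]].
Proof.
have conds (s : compactification X) : is_stone_cech s -> normal_space X ->
    [/\ cond_T (basic_ext R s), cond_BS (basic_ext R s)
      & cond_S (basic_ext R s)].
  move=> sc nX; have cS := normal_cond_S (R := R) sc nX.
  by have [cT cBS] := cond_S_T_BS cS.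
split=> [e|//|s sc]; first exact: cond_normal.
by split=> [|[cT _ _]]; [exact: conds|apply: cond_normal; left; exact: cT].
Qed.
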